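(* Let $n\ge3$ and let $\phi=\tilde p/p$ be an irreducible rational inner function in $n$ variables of polydegree $(m_1,\dots,m_{n-1},1)$ with a vertical line singularity $\{\xi\}\times\mathbb{T}\subset\mathcal Z_p\cap\mathbb{T}^n$, $\xi=(\xi_1,\dots,\xi_{n-1})\in\mathbb{T}^{n-1}$. Suppose that $\mathcal Z_\sigma\cap\mathbb{T}^{n-1}$ is of pure real dimension $n-2$, so that $\mathcal Z_{\rho_\phi}\cap\mathbb{T}^{n-1}=\bigcup_{i=1}^N M_i$ for some $N\in\mathbb{N}$, where each $M_i$ is a real manifold of dimension $n-2$. Let $1\le\mathfrak p<\infty$. If $$\int_{B_\varepsilon(\xi)}\sigma(z_1,\dots,z_{n-1})^{1-\mathfrak p}\,dm(z_1,\dots,z_{n-1})<\infty$$ for small $\varepsilon>0$, then $$\int_{B_\delta(\xi)}\rho_\phi(z_1,\dots,z_{n-1})^{1-\mathfrak p}\,dm(z_1,\dots,z_{n-1})<\infty$$ for some $0<\delta\le\varepsilon$. Specifically, this means that the local $L^{\mathfrak p}_{loc}(\mathbb{T}^n)$-integrability of $\frac{\partial\phi}{\partial z_n}$ at $(\xi,\tau)$, $\tau\in\mathbb{T}$, cannot make the global $L^{\mathfrak p}(\mathbb{T}^n)$-integrability of $\frac{\partial\phi}{\partial z_n}$ worse.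
   Context: $\mathbb{D}$ is the open unit disk in $\mathbb{C}$ and $\mathbb{T}$ the unit circle. A polynomial $p\in\mathbb{C}[z_1,\dots,z_n]$ is stable if it has no zeros in $\mathbb{D}^n$; $\mathcal Z_p$ is its zero set. If $p$ has polydegree $(m_1,\dots,m_n)$ ($m_j$ is the degree in $z_j$), its reflection is $\tilde p(z)=z_1^{m_1}\cdots z_n^{m_n}\overline{p(1/\bar z_1,\dots,1/\bar z_n)}$. A rational inner function (RIF) here is $\phi=\tilde p/p$ with $p$ stable and $p,\tilde p$ without common factors; the polydegree of $\phi$ is that of $p$; $\phi$ is irreducible if $p$ is an irreducible polynomial. If $\phi$ has polydegree $(m_1,\dots,m_{n-1},1)$, write $z'=(z_1,\dots,z_{n-1})$, $p(z)=p_1(z')+p_2(z')z_n$ and $\tilde p(z)=\tilde p_1(z')z_n+\tilde p_2(z')$, where $\tilde p_j(z')=z_1^{m_1}\cdots z_{n-1}^{m_{n-1}}\overline{p_j(1/\bar z_1,\dots,1/\bar z_{n-1})}$. Set $\sigma=|\tilde p_1|^2-|\tilde p_2|^2$ on $\mathbb{T}^{n-1}$, and $\rho_\phi=\sigma/|\tilde p_1|^2$ at the points of $\mathbb{T}^{n-1}$ where $\tilde p_1\neq0$. $\mathcal Z_\sigma\cap\mathbb{T}^{n-1}$ is the zero set of $\sigma$, and $\mathcal Z_{\rho_\phi}\cap\mathbb{T}^{n-1}$ is the set of points of $\mathbb{T}^{n-1}$ where $\rho_\phi$ is defined and equals zero. A vertical line singularity of $\phi$ is a set $\{\xi\}\times\mathbb{T}\subset\mathcal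 Z_p\cap\mathbb{T}^n$ with $\xi\in\mathbb{T}^{n-1}$; vertical lines need not be isolated. $B_\varepsilon(w)$ is the ball of radius $\varepsilon$ about $w$ in $\mathbb{T}^{n-1}$ and $dm$ is Lebesgue measure on $\mathbb{T}^{n-1}$. Local $L^{\mathfrak p}_{loc}(\mathbb{T}^n)$-integrability at a point refers to $L^{\mathfrak p}$-integrability on small neighbourhoods of that point; global integrability means membership in $L^{\mathfrak p}(\mathbb{T}^n)$. *)

(* Defs.v *)
From HB Require Import structures.
From mathcomp Require Import all_boot all_order all_algebra.
From mathcomp Require Import complex.
From mathcomp Require Import -(notations) mpoly.
From mathcomp Require Import all_classical all_reals all_analysis.

Set Implicit Arguments.
Unset Strict Implicit.
Unset Printing Implicit Defensive.

Import Order.TTheory GRing.Theory Num.Theory.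
Import numFieldNormedType.Exports.

Local Open Scope classical_set_scope.
Local Open Scope ring_scope.

Section Algebra.

Definition irreducible_elt (A : comUnitRingType) (a : A) : Prop :=
  [/\ a != 0, a \isn't a GRing.unit &
      forall b c : A, a = b * c -> b \is a GRing.unit \/ c \is a GRing.unit].

Definition no_common_factor (A : comUnitRingType) (a b : A) : Prop :=
  forall c a' b' : A, a = c * a' -> b = c * b' -> c \is a GRing.unit.

Variable R : realType.

Definition polydegree n (p : mpoly n R[i]) : multinom n :=
  Multinom [tuple (\max_(a <- msupp p) a i)%N | i < n].

(* z ^ m * conj (p (1 / conj z)) when the exponents of p are bounded by m
   (see [peval_reflect]); the exponent subtraction is truncated. *)
Definition reflect_with n (m : multinom n) (p : mpoly n R[i]) : mpoly n R[i] :=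
  \sum_(a <- msupp p) (mcoeff a p)^*%C *: mpolyX R[i] (mnm_sub m a).

Definition reflection n (p : mpoly n R[i]) : mpoly n R[i] :=
  reflect_with (polydegree p) p.

Lemma le_polydegree n (p : mpoly n R[i]) (a : multinom n) (i : 'I_n) :
  a \in msupp p -> (a i <= polydegree p i)%N.
Proof.
move=> ap; rewrite /polydegree multinomE tnth_mktuple.
exact: (leq_bigmax_seq (F := fun b : multinom n => b i)).
Qed.

Lemma meval_reflect n (m : multinom n) (p : mpoly n R[i]) (z : 'I_n -> R[i]) :
  (forall i, z i != 0) ->
  (forall a i, a \in msupp p -> (a i <= m i)%N) ->
  meval z (reflect_with m p) =
  (\prod_(i < n) z i ^+ m i) * (meval (fun i => ((z i)^*%C)^-1) p)^*%C.
Proof.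
move=> z0 pm; rewrite /reflect_with raddf_sum /= mevalE rmorph_sum mulr_sumr.
rewrite big_seq [RHS]big_seq; apply: eq_bigr => a ap.
rewrite mevalZ mevalX rmorphM /= [RHS]mulrCA; congr (_ * _).
rewrite rmorph_prod -[RHS]big_split /=; apply: eq_bigr => i _.
rewrite rmorphXn /= fmorphV /= conjcK mnmBE exprVn -expfB_cond //.
by rewrite (negPf (z0 i)) add0n pm.
Qed.

End Algebra.

Section RationalInner.
Variable R : realType.
Local Notation C := R[i].

(* The real-valued modulus; [`|z|] is valued in R[i]. *)
Definition modulus (z : C) : R := Normc.normc z.

Definition polydisk n : set ('I_n -> C) := [set z | forall i, modulus (z i) < 1].
Definition torus n : set ('I_n -> C) := [set z | forall i, modulus (z i) = 1].

Definition stable n (p : mpoly n C) : Prop :=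
  forall z, polydisk z -> meval z p != 0.

(* p is the denominator of the rational inner function [reflection p / p]. *)
Definition rif_denominator n (p : mpoly n C) : Prop :=
  stable p /\ no_common_factor p (reflection p).

Definition rif n (p : mpoly n C) (z : 'I_n -> C) : C :=
  meval z (reflection p) / meval z p.

Definition nonpole n (p : mpoly n C) : set ('I_n -> C) :=
  [set z | meval z p != 0].

(* The complex derivative in the j-th variable. *)
Definition partial n (j : 'I_n) (F : ('I_n -> C) -> C) (z : 'I_n -> C) : C :=
  derive1 (fun w : C^o => F (fun i => if i == j then w else z i) : C^o) (z j).

(* (z', z_n) *)
Definition rcons_pt d (z : 'I_d -> C) (w : C) : 'I_d.+1 -> C :=
  fun i => if unlift ord_max i is Some j then z j else w.

Section Sigma.
Variables (d : nat) (q1 q2 : mpoly d C).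

Definition sigma (z : 'I_d -> C) : R :=
  modulus (meval z q1) ^+ 2 - modulus (meval z q2) ^+ 2.

Definition rho (z : 'I_d -> C) : R := sigma z / modulus (meval z q1) ^+ 2.

Definition Zsigma : set ('I_d -> C) := torus (n := d) `&` [set z | sigma z = 0].

Definition rho_dom : set ('I_d -> C) :=
  torus (n := d) `&` [set z | meval z q1 != 0].

Definition Zrho : set ('I_d -> C) := rho_dom `&` [set z | rho z = 0].

End Sigma.

Definition tball n (e : R) (w : 'I_n -> C) : set ('I_n -> C) :=
  torus (n := n) `&`
  [set z | Num.sqrt (\sum_(i < n) modulus (z i - w i) ^+ 2) < e].

(* Coordinates on the torus by angles. *)
Definition torus_pt n (t : 'I_n -> R) : 'I_n -> C :=
  fun i => (cos (t i) +i* sin (t i))%C.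

End RationalInner.

Section TorusMeasure.
Variable R : realType.
Local Notation C := R[i].
Local Notation RT := (measurableTypeR R).

Definition cons_tuple n (x : RT * n.-tuple RT) : n.+1.-tuple RT :=
  [tuple of x.1 :: x.2].

Lemma measurable_cons_tuple n : measurable_fun setT (@cons_tuple n).
Proof. exact: measurable_cons. Qed.

HB.instance Definition _ n :=
  isMeasurableFun.Build _ _ _ _ (@cons_tuple n) (@measurable_cons_tuple n).

Lemma lt0_2pi : 0 < 2 * pi :> R.
Proof. by rewrite mulr_gt0 // pi_gt0. Qed.

(* Normalized Lebesgue measure on the torus, in angle coordinates: the n-fold
   product of the uniform probability on [0, 2 pi]. *)
Fixpoint angle_measure n : probability (n.-tuple RT) R :=
  match n with
  | 0 => dirac [tuple]
  | n.+1 => distribution (uniform_prob lt0_2pi \x angle_measure n)%E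
              (@cons_tuple n)
  end.

Definition angles n (A : set ('I_n -> C)) : set (n.-tuple RT) :=
  [set t | A (torus_pt (tnth t))].

Definition torus_integral n (A : set ('I_n -> C)) (F : ('I_n -> C) -> \bar R)
    : \bar R :=
  (\int[angle_measure n]_(t in angles A) F (torus_pt (tnth t)))%E.

Definition Lp_integrable n (q : R) (A : set ('I_n -> C))
    (F : ('I_n -> C) -> C) : Prop :=
  (angle_measure n).-integrable (angles A)
    (fun t => (modulus (F (torus_pt (tnth t))) `^ q)%:E).

Definition global_Lp n (q : R) (D : set ('I_n -> C)) (F : ('I_n -> C) -> C) :
    Prop :=
  Lp_integrable q (torus (n := n) `&` D) F.

Definition local_Lp n (q : R) (D : set ('I_n -> C)) (F : ('I_n -> C) -> C)
    (w : 'I_n -> C) : Prop :=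
  exists2 r : R, 0 < r & Lp_integrable q (tball r w `&` D) F.

(* x ^ r for x >= 0, with 0 ^ r = +oo for r < 0, where [powR] has value 0. *)
Definition epow (x r : R) : \bar R :=
  if (x == 0) && (r < 0) then +oo%E else (x `^ r)%:E.

End TorusMeasure.

Section Manifolds.
Variable R : realType.

Definition topological_manifold (X : topologicalType) (k : nat) (M : set X) :
    Prop :=
  forall x, M x -> exists (U : set X) (V : set 'rV[R]_k)
    (f : X -> 'rV[R]_k) (g : 'rV[R]_k -> X),
  [/\ open U /\ U x, open V,
      {within M `&` U, continuous f} /\ {within V, continuous g},
      forall y, (M `&` U) y -> V (f y) /\ g (f y) = y &
      forall v, V v -> (M `&` U) (g v) /\ f (g v) = v].

(* Dimension as for semialgebraic sets: the largest dimension of a nonempty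
   manifold contained in the set; purity requires it near every point. *)
Definition pure_dimension (X : topologicalType) (k : nat) (S : set X) : Prop :=
  (forall x U, S x -> open U -> U x ->
     exists M, [/\ M !=set0, M `<=` S `&` U & topological_manifold k M]) /\
  (forall k' M, M !=set0 -> M `<=` S -> topological_manifold k' M ->
     (k' <= k)%N).

(* The angle map from R^n to the torus is a local homeomorphism, so subsets of
   the torus may be examined through their preimages. *)
Definition lift_angles n (A : set ('I_n -> R[i])) : set 'rV[R]_n :=
  [set x | A (torus_pt (fun i => x 0 i))].

Definition torus_manifold n (k : nat) (M : set ('I_n -> R[i])) : Prop :=
  M `<=` torus (n := n) /\ topological_manifold k (lift_angles M).

Definition torus_pure_dimension n (k : nat) (S : set ('I_n -> R[i])) : Prop :=
  S `<=` torus (n := n) /\ pure_dimension k (lift_angles S).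

End Manifolds.

(* Main.v *)
(** On the torus, [phi]'s last partial derivative has modulus
    [sigma / |p1 + p2 w| ^ 2], a Poisson kernel in the last variable [w], and
    [sigma = |p1| ^ 2 - |p2| ^ 2 >= 0] by stability.  Its average over the
    circle is 1 and its maximum is at most [(|p1| + |p2|) ^ 2 / sigma], so the
    circle average of its power [q] is at most a constant times
    [sigma ^ (1 - q)], which Fubini turns into local integrability near
    [{xi} x T].  Since [p1] is bounded, [rho ^ (1 - q)] is dominated by
    [sigma ^ (1 - q)] as well.  Global integrability is local integrability at
    every point, because the torus is compact. *)
Require Import Defs.
From HB Require Import structures.
From mathcomp Require Import all_boot all_order all_algebra.
From mathcomp Require Import complex.
From mathcomp Require Import -(notations) mpoly.
From mathcomp Require Import all_classical all_reals all_analysis.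
From mathcomp Require Import measurable_realfun.
From mathcomp Require Import ring lra.
Set Implicit Arguments.
Unset Strict Implicit.
Unset Printing Implicit Defensive.
Import Order.TTheory GRing.Theory Num.Theory.
Import numFieldNormedType.Exports.
Local Open Scope classical_set_scope.
Local Open Scope ring_scope.

(** The maximum of the kernel comes from [|p1 + p2 w| >= |p1| - |p2|] and the factorization
    [sigma = (|p1| - |p2|) (|p1| + |p2|)]. Writing [P ^ q = P ^ (q - 1) * P] for the kernel [P] and
    bounding only the first factor keeps one copy of [P] to integrate to 1; bounding all of [P ^ q]
    by its maximum would give the weaker [sigma ^ (- q)]. Degenerate points need no separate
    null-set argument. Where [sigma] vanishes the kernel is 0 off the poles, and the convention for
    division by 0 makes it 0 at the poles, so the circle estimate holds over every point of the
    torus and the kernel can be integrated without removing the poles. In the global statement, the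
    hypothesis on [sigma] yields one radius that serves all points of the line over [xi]; what
    remains is exactly local integrability at the points off that line. *)

Section Modulus.
Variable R : realType.
Implicit Types x y z : R[i].

Lemma normr_modulus z : `|z| = ((modulus z)%:C)%C.
Proof. by []. Qed.

Lemma modulus_ge0 z : 0 <= modulus z.
Proof. by case: z => a b; exact: sqrtr_ge0. Qed.

Lemma modulus0 : modulus (0 : R[i]) = 0.
Proof. exact: Normc.normc0. Qed.

Lemma modulus1 : modulus (1 : R[i]) = 1.
Proof. exact: Normc.normc1. Qed.

Lemma modulusM x y : modulus (x * y) = modulus x * modulus y.
Proof. exact: Normc.normcM. Qed.

Lemma modulusV x : modulus x^-1 = (modulus x)^-1.
Proof. exact: Normc.normcV. Qed.

Lemma modulusX x n : modulus (x ^+ n) = modulus x ^+ n.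
Proof.
by elim: n => [|n IHn]; rewrite ?expr0 ?modulus1// !exprS modulusM IHn.
Qed.

Lemma modulus_prod n (f : 'I_n -> R[i]) :
  modulus (\prod_(i < n) f i) = \prod_(i < n) modulus (f i).
Proof. exact: (big_morph _ modulusM modulus1). Qed.

Lemma modulusN x : modulus (- x) = modulus x.
Proof. by case: x => a b; rewrite /modulus /= !sqrrN. Qed.

Lemma modulus_conj x : modulus (x^*)%C = modulus x.
Proof. by case: x => a b; rewrite /modulus /= sqrrN. Qed.

Lemma modulus_real (r : R) : 0 <= r -> modulus (r%:C)%C = r.
Proof. by move=> r0; rewrite /modulus /= expr0n addr0 sqrtr_sqr ger0_norm. Qed.

Lemma modulus_eq0 z : (modulus z == 0) = (z == 0).
Proof.
by apply/eqP/eqP => [/Normc.eq0_normc//|->]; exact: modulus0.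
Qed.

Lemma modulus_gt0 z : (0 < modulus z) = (z != 0).
Proof. by rewrite lt_neqAle modulus_ge0 andbT eq_sym modulus_eq0. Qed.

Lemma modulusD x y : modulus (x + y) <= modulus x + modulus y.
Proof.
by have := ler_normD x y; rewrite !normr_modulus -rmorphD/= lecR.
Qed.

Lemma modulus_sqr z : modulus z ^+ 2 = complex.Re z ^+ 2 + complex.Im z ^+ 2.
Proof. by case: z => a b; rewrite /modulus sqr_sqrtr// addr_ge0// sqr_ge0. Qed.

Lemma mulc_conj z : z * (z^*)%C = ((modulus z ^+ 2)%:C)%C.
Proof.
rewrite modulus_sqr; case: z => a b; apply/eqP; rewrite eq_complex/=.
by apply/andP; split; apply/eqP; ring.
Qed.

Lemma conjc_inv_unimodular z : modulus z = 1 -> ((z^*)%C)^-1 = z.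
Proof.
move=> z1; have z0 : (z^*)%C != 0 by rewrite -modulus_gt0 modulus_conj z1.
by apply: (mulIf z0); rewrite mulVf// mulc_conj z1 expr1n.
Qed.

Lemma modulus_cos_sin (t : R) : modulus (cos t +i* sin t)%C = 1.
Proof. by rewrite /modulus /= cos2Dsin2 sqrtr1. Qed.

Lemma torus_pt_torus n (t : 'I_n -> R) : torus (torus_pt t).
Proof. by move=> i; exact: modulus_cos_sin. Qed.

End Modulus.

(** * Complex functions with real and imaginary parts in a class closed under sums and products *)

Section PolynomialClosure.
Variables (R : realType) (T : Type) (P : (T -> R) -> Prop).
Hypothesis Pcst : forall c, P (fun=> c).
Hypothesis PD : forall f g, P f -> P g -> P (fun t => f t + g t).
Hypothesis PM : forall f g, P f -> P g -> P (fun t => f t * g t).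

(** The class [P] is kept abstract because it is used both for continuous and for measurable real
    functions; polynomial evaluation is then treated once for both. *)
Definition ReIm_in (f : T -> R[i]) : Prop :=
  P (fun t => complex.Re (f t)) /\ P (fun t => complex.Im (f t)).

Lemma ReIm_in_cst c : ReIm_in (fun=> c).
Proof. by split. Qed.

Lemma ReIm_inD f g : ReIm_in f -> ReIm_in g -> ReIm_in (fun t => f t + g t).
Proof.
move=> [f1 f2] [g1 g2]; split.
- rewrite [X in P X](_ : _ = fun t => complex.Re (f t) + complex.Re (g t)).
    exact: PD.
  by apply/funext => t; case: (f t) (g t) => a b [].
- rewrite [X in P X](_ : _ = fun t => complex.Im (f t) + complex.Im (g t)).
    exact: PD.
  by apply/funext => t; case: (f t) (g t) => a b [].
Qed.

Lemma ReIm_inM f g : ReIm_in f -> ReIm_in g -> ReIm_in (fun t => f t * g t).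
Proof.
move=> [f1 f2] [g1 g2]; split.
- rewrite [X in P X](_ : _ = fun t => complex.Re (f t) * complex.Re (g t) +
      (-1) * (complex.Im (f t) * complex.Im (g t))).
    by do !apply: PD || apply: PM.
  by apply/funext => t; case: (f t) (g t) => a b [c e] /=; rewrite mulN1r.
- rewrite [X in P X](_ : _ = fun t => complex.Re (f t) * complex.Im (g t) +
      complex.Im (f t) * complex.Re (g t)).
    by do !apply: PD || apply: PM.
  by apply/funext => t; case: (f t) (g t) => a b [c e].
Qed.

Lemma ReIm_in_meval n (z : T -> 'I_n -> R[i]) (p : mpoly n R[i]) :
  (forall i, ReIm_in (z^~ i)) -> ReIm_in (fun t => meval (z t) p).
Proof.
move=> zP; under eq_fun do rewrite mevalE.
elim: (msupp p) => [|a s IHs].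
  by under eq_fun do rewrite big_nil; exact: ReIm_in_cst.
under eq_fun do rewrite big_cons; apply: ReIm_inD => //.
apply: ReIm_inM; first exact: ReIm_in_cst.
elim: (index_enum _) => [|i r IHr].
  by under eq_fun do rewrite big_nil; exact: ReIm_in_cst.
under eq_fun do rewrite big_cons; apply: ReIm_inM => //.
elim: (a i) => [|k IHk]; first by under eq_fun do rewrite expr0; exact: ReIm_in_cst.
by under eq_fun do rewrite exprS; exact: ReIm_inM.
Qed.

(** The square is essential: it is a polynomial in the real and imaginary parts, whereas the modulus
    needs closure under square roots. *)
Lemma sqr_modulus_in f : ReIm_in f -> P (fun t => modulus (f t) ^+ 2).
Proof.
move=> [f1 f2]; under eq_fun do rewrite modulus_sqr !expr2.
by apply: PD; exact: PM.
Qed.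

End PolynomialClosure.

(** * Polynomials of degree one in the last variable, and the sign of [sigma] *)

Section AffineLastVariable.
Variables (R : realType) (d : nat).
Implicit Types (z : 'I_d -> R[i]) (w : R[i]) (r : mpoly d R[i]).

Lemma rcons_pt_max z w : rcons_pt z w ord_max = w.
Proof. by rewrite /rcons_pt unlift_none. Qed.

Lemma rcons_pt_lift z w (i : 'I_d) : rcons_pt z w (lift ord_max i) = z i.
Proof. by rewrite /rcons_pt liftK. Qed.

Lemma widen_lift_max (i : 'I_d) :
  widen_ord (leqnSn d) i = lift ord_max i :> 'I_d.+1.
Proof. by apply: val_inj => /=; rewrite /bump leqNgt ltn_ord. Qed.

Lemma mwiden_sum r : mwiden r =
  \sum_(a <- msupp r) mcoeff a r *: mpolyX R[i] (mnmwiden a).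
Proof.
rewrite {1}(mpolyE r) raddf_sum /=.
by apply: eq_bigr => a _; rewrite mwidenZ mwidenX.
Qed.

Lemma meval_mwiden z w r : meval (rcons_pt z w) (mwiden r) = meval z r.
Proof.
rewrite mwiden_sum raddf_sum /= mevalE; apply: eq_bigr => a _.
rewrite mevalZ mevalX; congr (_ * _).
rewrite big_ord_recr /= mnmwiden_ordmax expr0 mulr1.
apply: eq_bigr => i _.
by rewrite mnmwiden_widen widen_lift_max rcons_pt_lift.
Qed.

Lemma mcoeff_mwiden_eq0 r (k : multinom d.+1) :
  k ord_max != 0%N -> mcoeff k (mwiden r) = 0.
Proof.
move=> k0; rewrite mwiden_sum raddf_sum /= big1// => a _.
rewrite mcoeffZ mcoeffX; case: eqP => [ak|_]; last by rewrite mulr0.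
by rewrite -ak mnmwiden_ordmax eqxx in k0.
Qed.

Variables (p : mpoly d.+1 R[i]) (m : multinom d) (p1 p2 : mpoly d R[i]).
Hypothesis hdeg : polydegree p = mnm_add (mnmwiden m) (mnm1 ord_max).
Hypothesis hp : p = mwiden p1 + mwiden p2 * mpolyX R[i] (mnm1 ord_max).

Lemma meval_affine z w :
  meval (rcons_pt z w) p = meval z p1 + meval z p2 * w.
Proof.
rewrite hp mevalD mevalM mevalXU rcons_pt_max.
by congr (_ + _ * _); exact: meval_mwiden.
Qed.

Lemma polydegree_lift (i : 'I_d) : polydegree p (lift ord_max i) = m i.
Proof.
rewrite hdeg mnmDE -widen_lift_max mnmwiden_widen mnm1E.
by rewrite widen_lift_max (negPf (neq_lift _ _)) addn0.
Qed.

Lemma polydegree_max : polydegree p ord_max = 1%N.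
Proof. by rewrite hdeg mnmDE mnmwiden_ordmax mnm1E eqxx. Qed.

(** The two summands of [p] have last exponents 0 and 1, so no monomial of [p1] is cancelled in [p].
    With this bound the truncated subtraction in [reflect_with m p1] is an exact one. *)
Lemma msupp_p1 (a : multinom d) (i : 'I_d) : a \in msupp p1 -> (a i <= m i)%N.
Proof.
move=> ap1; rewrite -polydegree_lift.
have ap : mnmwiden a \in msupp p.
  rewrite mcoeff_msupp hp mcoeffD mwiden_mnmwiden.
  suff -> : mcoeff (mnmwiden a)
      (mwiden p2 * mpolyX R[i] (mnm1 ord_max)) = 0.
    by rewrite addr0 -mcoeff_msupp.
  apply/eqP; rewrite mcoeff_eq0 (perm_mem (msuppMX _ _)).
  apply/negP => /mapP[b _ /(congr1 (fun k : multinom d.+1 => k ord_max))].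
  by rewrite mnmwiden_ordmax mnmDE mnm1E eqxx.
have := le_polydegree (lift ord_max i) ap.
by rewrite -[in X in (X <= _)%N]widen_lift_max mnmwiden_widen.
Qed.

Lemma msupp_p2 (a : multinom d) (i : 'I_d) : a \in msupp p2 -> (a i <= m i)%N.
Proof.
move=> ap2; rewrite -polydegree_lift.
have ap : mnm_add (mnm1 ord_max) (mnmwiden a) \in msupp p.
  rewrite mcoeff_msupp hp mcoeffD mcoeffMX mwiden_mnmwiden.
  rewrite mcoeff_mwiden_eq0 ?add0r -?mcoeff_msupp//.
  by rewrite mnmDE mnm1E eqxx.
have := le_polydegree (lift ord_max i) ap.
rewrite mnmDE -{2}widen_lift_max mnmwiden_widen; apply: leq_trans.
exact: leq_addl.
Qed.

(** On the torus [1 / conj z = z] and the monomial prefactor is unimodular. *)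
Lemma modulus_reflect_with r z : torus z ->
  (forall a i, a \in msupp r -> (a i <= m i)%N) ->
  modulus (meval z (reflect_with m r)) = modulus (meval z r).
Proof.
move=> tz rm; rewrite meval_reflect//; last first.
  by move=> i; rewrite -modulus_gt0 tz.
rewrite modulusM modulus_conj modulus_prod big1 ?mul1r => [|i _]; last first.
  by rewrite modulusX tz expr1n.
by congr modulus; apply: meval_eq => i; exact: conjc_inv_unimodular.
Qed.

Lemma modulus_q1 z : torus z ->
  modulus (meval z (reflect_with m p1)) = modulus (meval z p1).
Proof. by move=> tz; apply: modulus_reflect_with => // a i; exact: msupp_p1. Qed.

Lemma modulus_q2 z : torus z ->
  modulus (meval z (reflect_with m p2)) = modulus (meval z p2).
Proof. by move=> tz; apply: modulus_reflect_with => // a i; exact: msupp_p2. Qed.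

Lemma sigmaE z : torus z ->
  sigma (reflect_with m p1) (reflect_with m p2) z =
  modulus (meval z p1) ^+ 2 - modulus (meval z p2) ^+ 2.
Proof. by move=> tz; rewrite /sigma modulus_q1// modulus_q2. Qed.

(** Only [z] is confined to the torus: the complex derivative in [w] needs this formula on a full
    neighbourhood of a point of the circle. *)
Lemma meval_reflection z w : torus z -> w != 0 ->
  meval (rcons_pt z w) (reflection p) =
  (\prod_(i < d) z i ^+ m i) *
  (w * ((meval z p1)^*)%C + ((meval z p2)^*)%C).
Proof.
move=> tz w0; rewrite meval_reflect; first last.
- by move=> a i; exact: le_polydegree.
- move=> i; rewrite /rcons_pt; case: (unlift _ _) => [j|//].
  by rewrite -modulus_gt0 tz.
rewrite big_ord_recr /= polydegree_max rcons_pt_max expr1 -mulrA.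
congr (_ * _).
  apply: eq_bigr => i _.
  by rewrite widen_lift_max rcons_pt_lift polydegree_lift.
have -> : meval (fun i => ((rcons_pt z w i)^*%C)^-1) p =
    meval z p1 + meval z p2 * ((w^*)%C)^-1.
  rewrite -meval_affine; apply: meval_eq => i.
  rewrite /rcons_pt; case: (unlift _ _) => [j|//].
  exact: conjc_inv_unimodular.
rewrite rmorphD rmorphM fmorphV /= conjcK mulrDr; congr (_ + _).
by rewrite mulrCA divff// mulr1.
Qed.

Hypothesis hstable : stable p.

Lemma le_modulus_polydisk z : polydisk z ->
  modulus (meval z p2) <= modulus (meval z p1).
Proof.
move=> dz; rewrite leNgt; apply/negP => lt12.
have p20 : meval z p2 != 0.
  by rewrite -modulus_gt0 (le_lt_trans _ lt12)// modulus_ge0.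
(* The root of [p] in its last variable; [lt12] places it in the open disk, against stability. *)
pose w := - (meval z p1 / meval z p2).
have dzw : polydisk (rcons_pt z w).
  move=> i; rewrite /rcons_pt; case: (unlift _ _) => [j|]; first exact: dz.
  by rewrite modulusN modulusM modulusV ltr_pdivrMr ?mul1r// modulus_gt0.
have := hstable dzw; rewrite meval_affine mulrN mulrCA divff// mulr1.
by rewrite subrr eqxx.
Qed.

(* The polydisk inequality passes to the torus along the radial segments. *)
Lemma le_modulus_torus z : torus z ->
  modulus (meval z p2) <= modulus (meval z p1).
Proof.
move=> tz; rewrite -(@ler_pXn2r _ 2)// ?nnegrE ?modulus_ge0//.
rewrite -subr_ge0.
pose zs (s : R) (i : 'I_d) := (s%:C)%C * z i.
pose f (s : R) := modulus (meval (zs s) p1) ^+ 2 +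
  (-1) * modulus (meval (zs s) p2) ^+ 2.
have cf : continuous f.
  have cD (g h : R -> R) : continuous g -> continuous h ->
    continuous (fun t => g t + h t).
    by move=> cg ch t; apply: continuousD; [exact: cg|exact: ch].
  have cM (g h : R -> R) : continuous g -> continuous h ->
    continuous (fun t => g t * h t).
    by move=> cg ch t; apply: continuousM; [exact: cg|exact: ch].
  have cc (c : R) : continuous (fun _ : R => c).
    by move=> t; exact: cvg_cst.
  have cz (r : mpoly d R[i]) :
      continuous (fun s : R => modulus (meval (zs s) r) ^+ 2).
    apply: (sqr_modulus_in cD cM); apply: (ReIm_in_meval cc cD cM) => i.
    change (ReIm_in (fun g : R -> R => continuous g)
      (fun s : R => (s%:C)%C * z i)).
    apply: (ReIm_inM cc cD cM); last exact: (ReIm_in_cst cc).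
    by split => /= t; [exact: cvg_id|exact: cvg_cst].
  apply: cD; first exact: cz.
  by apply: cM; [exact: cc|exact: cz].
have <- : f 1 = modulus (meval z p1) ^+ 2 - modulus (meval z p2) ^+ 2.
  by rewrite /f mulN1r; congr (modulus _ ^+ 2 - modulus _ ^+ 2);
     apply: meval_eq => i; rewrite /zs mul1r.
have /cvg_at_left_filter cl : f x @[x --> (1 : R)] --> f 1 by exact: cf.
rewrite -(cvg_lim (@Rhausdorff R) cl); apply: limr_ge.
  by apply/cvg_ex; exists (f 1).
near=> s.
have s0 : 0 < s by near: s; exact: nbhs_left_gt.
have s1 : s < 1 by near: s; exact: nbhs_left_lt.
rewrite /f mulN1r subr_ge0 ler_pXn2r ?nnegrE ?modulus_ge0//.
apply: le_modulus_polydisk => i.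
by rewrite /zs modulusM modulus_real ?(ltW s0)// tz mulr1.
Unshelve. all: by end_near. Qed.

Lemma sigma_ge0 z : torus z ->
  0 <= sigma (reflect_with m p1) (reflect_with m p2) z.
Proof.
move=> tz; rewrite sigmaE// subr_ge0 ler_pXn2r ?nnegrE ?modulus_ge0//.
exact: le_modulus_torus.
Qed.

End AffineLastVariable.

(** The formula for [f] is only required away from 0, since a reflection is evaluated by inverting
    the variable; as [w] is nonzero this still determines the germ at [w]. *)
Lemma derive1_moebius (K : numFieldType) (a b c e k w : K) (f : K^o -> K^o) :
  w != 0 -> a + b * w != 0 ->
  (forall v, v != 0 -> f v = k * (v * c + e) / (a + b * v)) ->
  derive1 f w = k * (a * c - b * e) / (a + b * w) ^+ 2.
Proof.
move=> w0 abw0 fE; rewrite /derive1.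
have cshift : (fun h : K => h + w) h @[h --> (0 : K)^'] --> (w : K).
  apply: cvg_within_filter; have {2}-> : w = 0 + w by rewrite add0r.
  by apply: (@cvgD K K^o); [exact: cvg_id|exact: cvg_cst].
have cden : (fun h : K => (a + b * (h + w) : K)) h @[h --> (0 : K)^'] -->
    (a + b * w : K).
  apply: (@cvgD K K^o); first exact: cvg_cst.
  by apply: (@cvgM K); [exact: cvg_cst|exact: cshift].
apply: (@cvg_lim K^o); first exact: norm_hausdorff.
(* This is the difference quotient of [f] after the factor [h] has cancelled. *)
have lim2 : (fun h : K => k * (a * c - b * e) /
    (a + b * w) * (a + b * (h + w))^-1 : K) h @[h --> (0 : K)^'] -->
    (k * (a * c - b * e) / (a + b * w) ^+ 2 : K).
  rewrite (_ : k * (a * c - b * e) / (a + b * w) ^+ 2 =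
      k * (a * c - b * e) / (a + b * w) * (a + b * w)^-1); last first.
    by field.
  by apply: (@cvgM K); [exact: cvg_cst|exact: (@cvgV K)].
apply: cvg_trans lim2; apply: near_eq_cvg; near=> h.
have h0 : h != 0 by near: h; exact: nbhs_dnbhs_neq.
have hw0 : h + w != 0 by near: h; exact: (@cvgr_neq0 K K^o _ _ _ _ _ cshift).
have den0 : a + b * (h + w) != 0.
  by near: h; exact: (@cvgr_neq0 K K^o _ _ _ _ _ cden).
rewrite !fE// /GRing.scale/=.
field.
by rewrite h0 abw0 den0.
Unshelve. all: by end_near. Qed.

(** * The last partial derivative on the torus *)

Section PartialDerivative.
Variables (R : realType) (d : nat).
Variables (p : mpoly d.+1 R[i]) (m : multinom d) (p1 p2 : mpoly d R[i]).
Hypothesis hdeg : polydegree p = mnm_add (mnmwiden m) (mnm1 ord_max).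
Hypothesis hp : p = mwiden p1 + mwiden p2 * mpolyX R[i] (mnm1 ord_max).
Hypothesis hstable : stable p.

(** For fixed [z] the function is a Moebius map in [w] with [c] and [e] the conjugates of [a] and
    [b], so its determinant [a c - b e] is [|a| ^ 2 - |b| ^ 2], that is [sigma]; nonnegativity of
    [sigma] then removes the modulus. *)
Lemma modulus_partial (z : 'I_d -> R[i]) (w : R[i]) :
  torus z -> modulus w = 1 -> meval (rcons_pt z w) p != 0 ->
  modulus (partial ord_max (rif p) (rcons_pt z w)) =
  sigma (reflect_with m p1) (reflect_with m p2) z /
  modulus (meval (rcons_pt z w) p) ^+ 2.
Proof.
move=> tz w1 pzw0; have w0 : w != 0 by rewrite -modulus_gt0 w1.
rewrite /partial rcons_pt_max.
have -> : (fun v : R[i]^o => rif p (fun i => if i == ord_max then v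
      else rcons_pt z w i) : R[i]^o) = (fun v => rif p (rcons_pt z v)).
  apply/funext => v; congr rif; apply/funext => i; rewrite /rcons_pt.
  by case: unliftP => [j ->|->]; rewrite ?eqxx// eq_sym (negPf (neq_lift _ _)).
rewrite (@derive1_moebius _ (meval z p1) (meval z p2)
  ((meval z p1)^*)%C ((meval z p2)^*)%C (\prod_(i < d) z i ^+ m i)); first last.
- by move=> v v0; rewrite /rif (meval_reflection hdeg hp tz v0)// (meval_affine hp).
- by rewrite -(meval_affine hp).
- exact: w0.
rewrite !modulusM modulusV modulusX -(meval_affine hp).
congr (_ / _); rewrite modulus_prod big1 ?mul1r => [|i _]; last first.
  by rewrite modulusX tz expr1n.
rewrite !mulc_conj -rmorphB/= -(sigmaE hdeg hp tz).
by apply: modulus_real; exact: (sigma_ge0 hdeg hp hstable tz).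
Qed.

End PartialDerivative.

(** * Integrating out the last angle *)

Section LastCoordinate.
Variable R : realType.
Local Notation RT := (measurableTypeR R).
Local Notation U := (uniform_prob (@lt0_2pi R)).
Local Open Scope ereal_scope.

(** [angle_measure] splits off the first angle, while the derivative concerns the last one. *)
Definition snoc_tuple n (x : n.-tuple RT * RT) : n.+1.-tuple RT :=
  [tuple of rcons x.1 x.2].

Lemma tnth_snoc_tuple_max n (x : n.-tuple RT * RT) :
  tnth (snoc_tuple x) ord_max = x.2.
Proof. by rewrite (tnth_nth x.2) /= nth_rcons size_tuple ltnn eqxx. Qed.

Lemma tnth_snoc_tuple_lift n (x : n.-tuple RT * RT) (i : 'I_n) :
  tnth (snoc_tuple x) (lift ord_max i) = tnth x.1 i.
Proof.
by rewrite !(tnth_nth x.2) lift_max /= nth_rcons size_tuple ltn_ord.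
Qed.

Lemma measurable_snoc_tuple n : measurable_fun setT (@snoc_tuple n).
Proof.
apply/measurable_fun_tnthP => i.
case: (unliftP ord_max i) => [j ->|->].
- rewrite (_ : _ \o _ = (fun t : n.-tuple RT => tnth t j) \o fst).
    exact: (measurableT_comp (measurable_tnth j)).
  by apply/funext => x /=; rewrite tnth_snoc_tuple_lift.
- rewrite (_ : _ \o _ = snd); first exact: measurable_snd.
  by apply/funext => x /=; rewrite tnth_snoc_tuple_max.
Qed.

Lemma integral_angle_measureS n (F : n.+1.-tuple RT -> \bar R) :
  measurable_fun setT F -> (forall t, 0 <= F t) ->
  \int[angle_measure R n.+1]_t F t =
  \int[U]_s \int[angle_measure R n]_t F (Defs.cons_tuple (s, t)).
Proof.
move=> mF F0; rewrite ge0_integral_distribution//.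
rewrite fubini_tonelli1//; last by move=> x; exact: F0.
by apply: measurableT_comp => //; exact: Defs.measurable_cons_tuple.
Qed.

(** By induction: both sides are unfolded at the first angle, and the induction hypothesis exchanges
    the order inside. For [n = 0] the remaining measure is a Dirac mass at the empty tuple, where
    prepending and appending agree. *)
Lemma integral_angle_measure_last n (F : n.+1.-tuple RT -> \bar R) :
  measurable_fun setT F -> (forall t, 0 <= F t) ->
  \int[angle_measure R n.+1]_t F t =
  \int[angle_measure R n]_t \int[U]_s F (snoc_tuple (t, s)).
Proof.
have mrc k (G : k.+1.-tuple RT -> \bar R) : measurable_fun setT G ->
    measurable_fun setT (fun x : k.-tuple RT * RT => G (snoc_tuple x)).
  by move=> mG; apply: (measurableT_comp mG); exact: measurable_snoc_tuple.
have mc k (s : RT) (G : k.+1.-tuple RT -> \bar R) : measurable_fun setT G ->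
    measurable_fun setT (fun t : k.-tuple RT => G (Defs.cons_tuple (s, t))).
  move=> mG; apply: (measurableT_comp mG); apply: measurable_cons.
    exact: measurable_cst.
  exact: measurable_id.
elim: n F => [|n IHn] F mF F0.
  rewrite integral_angle_measureS//= integral_dirac//=; last first.
    exact: (measurable_fun_fubini_tonelli_F (fun x => F (snoc_tuple x)) (mrc _ _ mF)).
  rewrite diracT mul1e; apply: eq_integral => s _.
  rewrite integral_dirac//=; last exact: mc.
  by rewrite diracT mul1e; congr F; exact: val_inj.
rewrite integral_angle_measureS//.
rewrite [RHS]integral_angle_measureS; first last.
- by move=> t; exact: integral_ge0.
- exact: (measurable_fun_fubini_tonelli_F (fun x => F (snoc_tuple x)) (mrc _ _ mF)).
apply: eq_integral => s _; rewrite IHn//; last exact: mc.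
apply: eq_integral => t _; apply: eq_integral => s' _; congr F.
exact: val_inj.
Qed.

End LastCoordinate.

(** * The circle average of the Poisson kernel *)

Section PoissonKernel.
Variable R : realType.
Local Notation RT := (measurableTypeR R).
Local Notation mu := (@lebesgue_measure R).
Local Notation U := (uniform_prob (@lt0_2pi R)).

Section RealForm.
Variables A c1 c2 : R.
Hypothesis A0 : 0 < A.
Hypothesis cA : c1 ^+ 2 + c2 ^+ 2 < A ^+ 2.

(** [u] and [v] are the real and imaginary parts of [A + c e^(i s)] with [c = c1 + i c2]. Since
    [|c| < A] the real part stays positive, so [atan (v / u)] is a smooth argument with no branch
    jump. *)
Let u (s : R) : R := A + (c1 * cos s - c2 * sin s).
Let v (s : R) : R := c1 * sin s + c2 * cos s.

Let u_gt0 s : 0 < u s.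
Proof.
have e : (c1 * cos s - c2 * sin s) ^+ 2 + (c1 * sin s + c2 * cos s) ^+ 2 =
    c1 ^+ 2 + c2 ^+ 2.
  by rewrite -[RHS]mulr1 -(cos2Dsin2 s); ring.
rewrite /u; set x := c1 * cos s - _ in e *.
have : x ^+ 2 < A ^+ 2 by rewrite (le_lt_trans _ cA)// -e lerDl sqr_ge0.
rewrite ltNge => /negP xA; rewrite ltNge; apply/negP => h; apply: xA.
have := A0; have : 0 <= (- x - A) * (A - x) by apply: mulr_ge0; have := A0; lra.
by rewrite !expr2; lra.
Qed.

Let den_gt0 s : 0 < u s ^+ 2 + v s ^+ 2.
Proof. by rewrite ltr_pwDl ?exprn_gt0 ?sqr_ge0// u_gt0. Qed.

(* The angle s minus twice the argument of the denominator. *)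
Let F (s : R) : R := s - 2 * atan (v s / u s).
Let f (s : R) : R := (A ^+ 2 - (c1 ^+ 2 + c2 ^+ 2)) / (u s ^+ 2 + v s ^+ 2).

Let is_derive_u (s : R) : is_derive s 1 u (- v s).
Proof.
rewrite /u; apply: is_derive_eq.
by rewrite /v /GRing.scale/=; ring.
Qed.

Let is_derive_v (s : R) : is_derive s 1 v (u s - A).
Proof.
rewrite /v; apply: is_derive_eq.
by rewrite /u /GRing.scale/=; ring.
Qed.

Let is_derive_F (s : R) : is_derive s 1 F (f s).
Proof.
have du := is_derive_u s; have dv := is_derive_v s.
have u0 : u s != 0 by rewrite gt_eqF// u_gt0.
have dui := is_deriveV (f := u) u0 du.
have dq : is_derive s 1 (fun t => v t / u t)
    ((u s ^+ 2 + v s ^+ 2 - A * u s) / u s ^+ 2).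
  apply: is_derive_eq (is_deriveM dv dui) _.
  by rewrite /GRing.scale/=; field.
have da := is_derive1_atan (v s / u s).
have dF := @is_derive1_comp R atan (fun t => v t / u t) s _ _ da dq.
have -> : F = id - (2 : R) *: (atan \o (fun t => v t / u t)) by apply/funext.
apply: is_derive_eq.
(* This is [|c e^(i s)| = |c|]. It turns the numerator [2 A u - (u ^ 2 + v ^ 2)] of the derivative
   into the constant [A ^ 2 - |c| ^ 2]. *)
have e : (u s - A) ^+ 2 + v s ^+ 2 = c1 ^+ 2 + c2 ^+ 2.
  by rewrite /u /v -[RHS]mulr1 -(cos2Dsin2 s); ring.
rewrite /GRing.scale/= /f -e; field.
by rewrite u0 gt_eqF// den_gt0.
Qed.

Let F_derivable (s : R) : derivable F s 1.
Proof. by case: (is_derive_F s). Qed.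

Let F_continuous : continuous F.
Proof.
move=> s; apply: differentiable_continuous; apply/derivable1_diffP.
exact: F_derivable.
Qed.

Lemma continuous_poisson : continuous f.
Proof.
have cu : continuous u.
  move=> s; apply: differentiable_continuous; apply/derivable1_diffP.
  by case: (is_derive_u s).
have cv : continuous v.
  move=> s; apply: differentiable_continuous; apply/derivable1_diffP.
  by case: (is_derive_v s).
move=> s; apply: cvgM; first exact: cvg_cst.
apply: cvgV; first by rewrite gt_eqF// den_gt0.
by apply: cvgD; apply: cvgM; (exact: cu || exact: cv).
Qed.

(** The arctangent term of [F] is periodic, so only the summand [s] contributes to the increment
    over a full turn. *)
Lemma integral_poisson_real :
  (\int[mu]_(s in `[0%R, (2 * pi)%R]) (f s)%:E = (2 * pi)%:E)%E.
Proof.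
rewrite (@continuous_FTC2 _ f F).
- have -> : 2 * pi = pi *+ 2 :> R by rewrite mulr_natl.
  rewrite -EFinB /F /u /v cos2pi sin2pi cos0 sin0; congr EFin; ring.
- exact: lt0_2pi.
- exact/continuous_subspaceT/continuous_poisson.
- split; first by move=> s _; exact: F_derivable.
  + by apply: cvg_at_right_filter; exact: F_continuous.
  + by apply: cvg_at_left_filter; exact: F_continuous.
- by move=> s _; rewrite derive1E; case: (is_derive_F s).
Qed.

End RealForm.

Lemma integral_poisson (a b : R[i]) : modulus b < modulus a ->
  (\int[U]_s ((modulus a ^+ 2 - modulus b ^+ 2) /
     modulus (a + b * (cos s +i* sin s)%C) ^+ 2)%:E = 1)%E.
Proof.
move=> ba.
have a0 : 0 < modulus a by rewrite (le_lt_trans _ ba)// modulus_ge0.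
(* Multiplying [a + b w] by the conjugate of [a] makes the constant term real and positive, as the
   real form requires. *)
pose A := modulus a ^+ 2; pose c := (a^*)%C * b.
have A0 : 0 < A by rewrite exprn_gt0.
have cE : complex.Re c ^+ 2 + complex.Im c ^+ 2 = A * modulus b ^+ 2.
  by rewrite -modulus_sqr modulusM modulus_conj exprMn.
have cA : complex.Re c ^+ 2 + complex.Im c ^+ 2 < A ^+ 2.
  by rewrite cE [ltRHS]expr2 ltr_pM2l// ltr_pXn2r// nnegrE modulus_ge0.
pose f (s : R) : R := (A ^+ 2 - (complex.Re c ^+ 2 + complex.Im c ^+ 2)) /
  ((A + (complex.Re c * cos s - complex.Im c * sin s)) ^+ 2 +
   (complex.Re c * sin s + complex.Im c * cos s) ^+ 2).
transitivity (\int[U]_s (f s)%:E)%E.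
  apply: eq_integral => s _; congr EFin; rewrite /f.
  have -> : (A + (complex.Re c * cos s - complex.Im c * sin s)) ^+ 2 +
     (complex.Re c * sin s + complex.Im c * cos s) ^+ 2 =
     A * modulus (a + b * (cos s +i* sin s)%C) ^+ 2.
    rewrite /A -(modulus_conj a) -exprMn -modulusM mulrDr mulrA -/c !modulus_conj.
    rewrite [(a^*)%C * a]mulrC mulc_conj [RHS]modulus_sqr.
    by case: (c) => c1 c2 /=; ring.
  by rewrite cE expr2 -mulrBr -mulf_div divff ?mul1r// gt_eqF.
have cf : continuous f by exact: continuous_poisson.
rewrite integral_uniform.
- rewrite integral_poisson_real// subr0 -EFinM mulVf// gt_eqF//.
  exact: lt0_2pi.
- by apply/measurable_EFinP; exact: continuous_measurable_fun.
- move=> s; rewrite lee_fin divr_ge0// ?subr_ge0 ?(ltW cA)//.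
  by rewrite addr_ge0// sqr_ge0.
Qed.

End PoissonKernel.

(** * Measurability in angle coordinates, and bounds for polynomials on the torus *)

Section TorusMeasurability.
Variable R : realType.
Local Notation RT := (measurableTypeR R).
Local Notation C := R[i].

Lemma measurable_sqrt : measurable_fun [set: R] (@Num.sqrt R).
Proof. by apply: continuous_measurable_fun; exact: sqrt_continuous. Qed.

Lemma ReIm_in_torus_pt n (i : 'I_n) :
  ReIm_in (fun f : n.-tuple RT -> R => measurable_fun setT f)
    (fun t => torus_pt (tnth t) i).
Proof.
split => /=.
- apply: (@measurableT_comp _ _ _ _ _ _ (@cos R)); last exact: measurable_tnth.
  by apply: continuous_measurable_fun; exact: continuous_cos.
- apply: (@measurableT_comp _ _ _ _ _ _ (@sin R)); last exact: measurable_tnth.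
  by apply: continuous_measurable_fun; exact: continuous_sin.
Qed.

Lemma ReIm_in_torus_meval n (p : mpoly n C) :
  ReIm_in (fun f : n.-tuple RT -> R => measurable_fun setT f)
    (fun t => meval (torus_pt (tnth t)) p).
Proof.
apply: (@ReIm_in_meval R (n.-tuple RT) (fun f => measurable_fun setT f)).
- by move=> c; exact: measurable_cst.
- by move=> f g; exact: measurable_funD.
- by move=> f g; exact: measurable_funM.
- exact: ReIm_in_torus_pt.
Qed.

Lemma measurable_modulus dT (T : measurableType dT) (f : T -> C) :
  ReIm_in (fun g : T -> R => measurable_fun setT g) f ->
  measurable_fun setT (fun t => modulus (f t)).
Proof.
move=> fP; rewrite (_ : (fun t => _) =
    @Num.sqrt R \o (fun t => modulus (f t) ^+ 2)); last first.
  by apply/funext => t /=; rewrite sqrtr_sqr ger0_norm// modulus_ge0.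
apply: (measurableT_comp measurable_sqrt).
apply: (@sqr_modulus_in R T (fun g => measurable_fun setT g)
  _ _ _ fP) => g h; [exact: measurable_funD|exact: measurable_funM].
Qed.

Lemma measurable_modulus_meval n (p : mpoly n C) :
  measurable_fun setT (fun t : n.-tuple RT => modulus (meval (torus_pt (tnth t)) p)).
Proof. by apply: measurable_modulus; exact: ReIm_in_torus_meval. Qed.

(** The inverse is the power with exponent -1, also at 0 where both have value 0; hence denominators
    may vanish. *)
Lemma measurable_inv_ge0 d (T : measurableType d) (f : T -> R) :
  (forall t, 0 <= f t) -> measurable_fun setT f ->
  measurable_fun setT (fun t => (f t)^-1).
Proof.
move=> f0 mf; under eq_fun do rewrite -powR_inv1//.
exact: (measurableT_comp (measurable_powR (-1))).
Qed.

Lemma measurable_epow d (T : measurableType d) (f : T -> R) (r : R) :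
  measurable_fun setT f -> measurable_fun setT (fun t => epow (f t) r).
Proof.
move=> mf; rewrite /epow; apply: measurable_fun_ifT.
- apply: measurable_and; last exact: measurable_cst.
  by apply: measurable_fun_eqr => //; exact: measurable_cst.
- exact: measurable_cst.
- by apply/measurable_EFinP; exact: (measurableT_comp (measurable_powR r)).
Qed.

Lemma epow_ge0 (x r : R) : (0 <= epow x r)%E.
Proof. by rewrite /epow; case: ifP => // _; rewrite lee_fin powR_ge0. Qed.

Lemma measurable_angles_tball n e (w : 'I_n -> C) :
  measurable (angles (tball e w)).
Proof.
rewrite (_ : angles _ = setT `&` (fun t : n.-tuple RT => Num.sqrt (\sum_(i < n)
    modulus (torus_pt (tnth t) i - w i) ^+ 2)) @^-1` `]-oo, e[).
  suff mf : measurable_fun setT (fun t : n.-tuple RT => Num.sqrt (\sum_(i < n)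
      modulus (torus_pt (tnth t) i - w i) ^+ 2)) by apply: mf.
  apply: (measurableT_comp measurable_sqrt).
  apply: measurable_sum => i; apply: measurable_funX.
  apply: measurable_modulus.
  have Pc c : measurable_fun [set: n.-tuple RT] (fun=> c : R) by exact: measurable_cst.
  apply: (@ReIm_inD R (n.-tuple RT) (fun g => measurable_fun setT g)) => //.
  - by move=> g h; exact: measurable_funD.
  - exact: ReIm_in_torus_pt.
rewrite setTI; apply/seteqP; split => t /=; rewrite in_itv/=.
- by case.
- by split => //; exact: torus_pt_torus.
Qed.

Lemma measurable_angles_nonpole n (p : mpoly n C) :
  measurable (angles (nonpole p)).
Proof.
rewrite (_ : angles _ = setT `&` (fun t : n.-tuple RT =>
    modulus (meval (torus_pt (tnth t)) p)) @^-1` (~` [set 0])).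
  apply: measurable_modulus_meval => //; exact: measurableC.
rewrite setTI; apply/seteqP; split => t /=; rewrite /angles /nonpole/=.
- by move=> /negP h; rewrite /preimage/= => /eqP; rewrite modulus_eq0.
- by rewrite /preimage/= => h; apply/eqP => p0; apply: h; rewrite p0 modulus0.
Qed.

Lemma anglesI n (A B : set ('I_n -> C)) : angles (A `&` B) = angles A `&` angles B.
Proof. by []. Qed.

Lemma angles_torus n : angles (torus (R := R) (n := n)) = setT.
Proof. by apply/seteqP; split => // t _; exact: torus_pt_torus. Qed.

Lemma torus_pt_rcons n (x : n.-tuple RT * RT) :
  torus_pt (tnth (snoc_tuple x)) =
  rcons_pt (torus_pt (tnth x.1)) (cos x.2 +i* sin x.2)%C.
Proof.
apply/funext => i; rewrite /torus_pt /rcons_pt.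
case: unliftP => [j ->|->]; first by rewrite tnth_snoc_tuple_lift.
by rewrite tnth_snoc_tuple_max.
Qed.

Lemma rcons_pt_split n (z : 'I_n.+1 -> C) :
  z = rcons_pt (fun i => z (lift ord_max i)) (z ord_max).
Proof. by apply/funext => i; rewrite /rcons_pt; case: unliftP => [j|] ->. Qed.

Lemma meval_mwiden_lift n (z : 'I_n.+1 -> C) (r : mpoly n C) :
  meval z (mwiden r) = meval (fun i => z (lift ord_max i)) r.
Proof. by rewrite {1}(rcons_pt_split z) meval_mwiden. Qed.

Lemma sigma_lift n (z : 'I_n.+1 -> C) (r1 r2 : mpoly n C) :
  sigma r1 r2 (fun i => z (lift ord_max i)) =
  modulus (meval z (mwiden r1)) ^+ 2 - modulus (meval z (mwiden r2)) ^+ 2.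
Proof.
rewrite /sigma; congr (modulus _ ^+ 2 - modulus _ ^+ 2); apply/esym;
  exact: meval_mwiden_lift.
Qed.

Lemma modulus_meval_bounded n (p : mpoly n C) :
  exists2 K, 0 < K & forall z, torus z -> modulus (meval z p) <= K.
Proof.
(* Monomials are unimodular on the torus; the summand 1 keeps the bound positive even for
   [p = 0]. *)
exists (1 + \sum_(a <- msupp p) modulus (mcoeff a p)).
  by rewrite ltr_wpDr// sumr_ge0// => a _; exact: modulus_ge0.
move=> z tz; rewrite mevalE; apply: ler_wpDl => //.
elim: (msupp p) => [|a s IHs]; first by rewrite !big_nil modulus0.
rewrite !big_cons; apply: le_trans (modulusD _ _) _; apply: lerD => //.
rewrite modulusM modulus_prod big1 ?mulr1// => i _.
by rewrite modulusX tz expr1n.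
Qed.

End TorusMeasurability.

(** * The circle average of a power of the kernel *)

Section LpEstimate.
Variables (R : realType) (d : nat).
Local Notation C := R[i].
Local Notation RT := (measurableTypeR R).
Local Notation U := (uniform_prob (@lt0_2pi R)).
Variables (p : mpoly d.+1 C) (m : multinom d) (p1 p2 : mpoly d C).
Hypothesis hdeg : polydegree p = mnm_add (mnmwiden m) (mnm1 ord_max).
Hypothesis hp : p = mwiden p1 + mwiden p2 * mpolyX C (mnm1 ord_max).
Hypothesis hstable : stable p.
Variable q : R.
Hypothesis hq : 1 <= q.
Local Notation q1 := (reflect_with m p1).
Local Notation q2 := (reflect_with m p2).

Let q_neq0 : q != 0.
Proof. by rewrite gt_eqF// (lt_le_trans _ hq). Qed.

(** The hypothesis bounds [x ^ (q - 1)], by monotonicity since [q >= 1]; the remaining factor [x] is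
    left to be integrated. *)
Lemma powR_le_split (K s x : R) : 0 < K -> 0 < s -> 0 <= x -> x <= K / s ->
  x `^ q <= K `^ (q - 1) * s `^ (1 - q) * x.
Proof.
move=> K0 s0; rewrite le_eqVlt => /orP[/eqP <- _|x0 xK].
  by rewrite mulr0 powR0.
have -> : x `^ q = x `^ (q - 1) * x.
  rewrite -[X in _ = _ * X](powRr1 (ltW x0)) -powRD ?subrK//.
  by rewrite (gt_eqF x0) implybT.
rewrite ler_pM2r//.
have -> : s `^ (1 - q) = s^-1 `^ (q - 1).
  by rewrite -(powR_inv1 (ltW s0)) -powRrM mulN1r opprB.
rewrite -powRM ?invr_ge0 ?(ltW K0) ?(ltW s0)//.
by apply: ge0_ler_powR; rewrite ?nnegrE ?subr_ge0 ?(ltW x0)// divr_ge0 ?ltW.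
Qed.

(* Equal to 0 at the poles, as division by 0 gives 0. *)
Definition poisson_density (z : 'I_d.+1 -> C) : R :=
  sigma q1 q2 (fun i => z (lift ord_max i)) / modulus (meval z p) ^+ 2.

Lemma poisson_density_rcons z w : poisson_density (rcons_pt z w) =
  sigma q1 q2 z / modulus (meval (rcons_pt z w) p) ^+ 2.
Proof.
rewrite /poisson_density; congr (sigma _ _ _ / _).
by apply/funext => i; rewrite rcons_pt_lift.
Qed.

Lemma modulus_partial_density z : torus z -> meval z p != 0 ->
  modulus (partial ord_max (rif p) z) = poisson_density z.
Proof.
rewrite (rcons_pt_split z); set z' := (fun i => z (lift ord_max i)) => tz pz.
rewrite poisson_density_rcons (modulus_partial hdeg hp hstable)//.
- by move=> i; have := tz (lift ord_max i); rewrite rcons_pt_lift.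
- by have := tz ord_max; rewrite rcons_pt_max.
Qed.

Definition density_pow (t : d.+1.-tuple RT) : \bar R :=
  (poisson_density (torus_pt (tnth t)) `^ q)%:E.

Lemma density_pow_ge0 t : (0 <= density_pow t)%E.
Proof. by rewrite lee_fin powR_ge0. Qed.

Lemma measurable_density_pow : measurable_fun setT density_pow.
Proof.
apply/measurable_EFinP; apply: (measurableT_comp (measurable_powR q)).
apply: measurable_funM; last first.
  apply: measurable_inv_ge0 => [t|]; first by rewrite exprn_ge0// modulus_ge0.
  by apply: measurable_funX; exact: measurable_modulus_meval.
rewrite (_ : (fun t => _) = fun t : d.+1.-tuple RT =>
  modulus (meval (torus_pt (tnth t)) (mwiden q1)) ^+ 2 -
  modulus (meval (torus_pt (tnth t)) (mwiden q2)) ^+ 2); last first.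
  by apply/funext => t; exact: sigma_lift.
by apply: measurable_funB; apply: measurable_funX; exact: measurable_modulus_meval.
Qed.

(** The density vanishes at the poles, so they may be put back into the domain of integration. Off
    the poles it is the modulus of the derivative, which therefore inherits measurability there. *)
Lemma Lp_integrable_density (A : set ('I_d.+1 -> C)) : measurable (angles A) ->
  Lp_integrable q (A `&` nonpole p) (partial ord_max (rif p)) <->
  (\int[angle_measure R d.+1]_(t in angles A) density_pow t < +oo)%E.
Proof.
move=> mA; rewrite /Lp_integrable anglesI.
have mN := measurable_angles_nonpole p.
have mAN : measurable (angles A `&` angles (nonpole p)) by exact: measurableI.
have E : {in angles A `&` angles (nonpole p),
    (fun t => (modulus (partial ord_max (rif p) (torus_pt (tnth t))) `^ q)%:E)
    =1 density_pow}.
  move=> t; rewrite inE => -[_ pt]; rewrite modulus_partial_density//.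
  exact: torus_pt_torus.
have I : (\int[angle_measure R d.+1]_(t in angles A `&` angles (nonpole p))
    density_pow t = \int[angle_measure R d.+1]_(t in angles A) density_pow t)%E.
  rewrite integral_mkcondr; apply: eq_integral => t _; rewrite patchE.
  case: ifPn => // /negP pt; rewrite /density_pow /poisson_density.
  have -> : meval (torus_pt (tnth t)) p = 0.
    by apply/eqP/negPn/negP => h; apply: pt; rewrite inE.
  by rewrite modulus0 expr0n/= invr0 mulr0 powR0.
rewrite -I; split.
- move=> /integrableP[_]; apply: le_lt_trans.
  rewrite le_eqVlt; apply/orP; left; apply/eqP; apply: eq_integral => t tAN.
  by rewrite -E// gee0_abs// lee_fin powR_ge0.
- move=> foo; apply/integrableP; split.
    apply: (eq_measurable_fun density_pow) => [t tAN|]; first by rewrite E.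
    exact: measurable_funTS measurable_density_pow.
  apply: le_lt_trans foo.
  rewrite le_eqVlt; apply/orP; left; apply/eqP; apply: eq_integral => t tAN.
  by rewrite -E// gee0_abs// lee_fin powR_ge0.
Qed.

Lemma integral_density_circle (K : R) z : torus z -> 0 < K ->
  modulus (meval z p1) + modulus (meval z p2) <= K ->
  (\int[U]_s ((poisson_density (rcons_pt z (cos s +i* sin s)%C)) `^ q)%:E <=
   ((K ^+ 2) `^ (q - 1))%:E * epow (sigma q1 q2 z) (1 - q))%E.
Proof.
move=> tz K0 zK.
under eq_integral => s _ do rewrite poisson_density_rcons (meval_affine hp).
have sE := sigmaE hdeg hp tz.
have := sigma_ge0 hdeg hp hstable tz.
(* If [sigma] is 0 at [z], the density is 0 on the whole circle, and the right-hand side is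
   nonnegative, possibly infinite. *)
rewrite le_eqVlt => /orP[/eqP <-|s0].
  under eq_integral => s _ do rewrite mul0r powR0//.
  by rewrite integral0 mule_ge0// ?epow_ge0// lee_fin powR_ge0.
rewrite /epow gt_eqF//=.
set a := meval z p1 in zK sE *; set b := meval z p2 in zK sE *.
have ab : modulus b < modulus a.
  by move: s0; rewrite sE subr_gt0 ltr_pXn2r ?nnegrE ?modulus_ge0.
have ms : measurable_fun setT (fun s : RT => modulus (a + b * (cos s +i* sin s)%C)).
  have Pc c : measurable_fun [set: RT] (fun=> c : R) by exact: measurable_cst.
  have PD (g h : RT -> R) : measurable_fun setT g -> measurable_fun setT h ->
    measurable_fun setT (fun t => g t + h t) by exact: measurable_funD.
  have PM (g h : RT -> R) : measurable_fun setT g -> measurable_fun setT h ->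
    measurable_fun setT (fun t => g t * h t) by exact: measurable_funM.
  apply: measurable_modulus.
  apply: (@ReIm_inD R RT (fun g => measurable_fun setT g) PD).
    exact: (@ReIm_in_cst R RT (fun g => measurable_fun setT g) Pc).
  apply: (@ReIm_inM R RT (fun g => measurable_fun setT g) Pc PD PM).
    exact: (@ReIm_in_cst R RT (fun g => measurable_fun setT g) Pc).
  split => /=; apply: continuous_measurable_fun; first exact: continuous_cos.
  exact: continuous_sin.
have mf : measurable_fun setT (fun s : RT => sigma q1 q2 z /
    modulus (a + b * (cos s +i* sin s)%C) ^+ 2).
  apply: measurable_funM; first exact: measurable_cst.
  apply: measurable_inv_ge0 => [s|]; first by rewrite exprn_ge0// modulus_ge0.
  exact: measurable_funX.
pose c := (K ^+ 2) `^ (q - 1) * (sigma q1 q2 z) `^ (1 - q).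
have c0 : 0 <= c by rewrite mulr_ge0// powR_ge0.
apply: (@le_trans _ _ (\int[U]_s (c%:E * (sigma q1 q2 z /
    modulus (a + b * (cos s +i* sin s)%C) ^+ 2)%:E))%E).
  apply: ge0_le_integral => //.
  - by move=> s _; rewrite lee_fin powR_ge0.
  - by apply/measurable_EFinP; exact: (measurableT_comp (measurable_powR q)).
  - by apply: measurable_funeM; exact/measurable_EFinP.
  - move=> s _; rewrite -EFinM lee_fin; apply: powR_le_split => //.
    + by rewrite exprn_gt0.
    + by rewrite divr_ge0 ?(ltW s0)// exprn_ge0// modulus_ge0.
    (* The required bound [sigma / X ^ 2 <= K ^ 2 / sigma] amounts to [sigma <= K X], which follows
       from [X >= |a| - |b|], [K >= |a| + |b|] and the factorization of [sigma]. *)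
    + have le_ab : modulus a - modulus b <=
          modulus (a + b * (cos s +i* sin s)%C).
        rewrite lerBlDr -[X in modulus X <= _](addrK (b * (cos s +i* sin s)%C)).
        apply: le_trans (modulusD _ _) _.
        by rewrite modulusN modulusM modulus_cos_sin mulr1.
      have X0 : 0 < modulus (a + b * (cos s +i* sin s)%C).
        by apply: lt_le_trans le_ab; rewrite subr_gt0.
      rewrite ler_pdivlMr// mulrAC ler_pdivrMr ?exprn_gt0//.
      rewrite -expr2 -exprMn ler_pXn2r ?nnegrE ?mulr_ge0 ?(ltW s0) ?(ltW K0) ?(ltW X0)//.
      rewrite sE subr_sqr mulrC.
      by rewrite ler_pM ?subr_ge0 ?(ltW ab) ?addr_ge0 ?modulus_ge0.
have poisson1 : (\int[U]_s (sigma q1 q2 z /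
    modulus (a + b * (cos s +i* sin s)%C) ^+ 2)%:E = 1)%E.
  by rewrite sE; exact: integral_poisson.
rewrite ge0_integralZl_EFin//.
- by rewrite poisson1 mule1 /c EFinM.
- move=> s _; rewrite lee_fin divr_ge0 ?(ltW s0)//.
  by rewrite exprn_ge0// modulus_ge0.
- exact/measurable_EFinP.
Qed.

End LpEstimate.

(** * Comparison of integrals *)

Lemma integral_lty_scaled dT (T : measurableType dT) (R : realType)
    (mu : {measure set T -> \bar R}) (D E : set T) (f g : T -> \bar R) (c : R) :
  measurable D -> measurable E -> D `<=` E ->
  measurable_fun setT f -> measurable_fun setT g ->
  (forall t, 0 <= f t)%E -> (forall t, 0 <= g t)%E -> 0 <= c ->
  (forall t, D t -> f t <= c%:E * g t)%E ->
  (\int[mu]_(t in E) g t < +oo)%E -> (\int[mu]_(t in D) f t < +oo)%E.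
Proof.
move=> mD mE DE mf mg f0 g0 c0 fg gE.
have mcg : measurable_fun setT (fun t => c%:E * g t)%E by exact: measurable_funeM.
apply: (@le_lt_trans _ _ (\int[mu]_(t in D) (c%:E * g t))%E).
  by apply: ge0_le_integral => //; exact: measurable_funTS.
rewrite ge0_integralZl_EFin//; last exact: measurable_funTS.
apply: lte_mul_pinfty; [by rewrite lee_fin|by []|].
apply: le_lt_trans gE; apply: ge0_subset_integral => //.
exact: measurable_funTS.
Qed.

(** The set [D] is enlarged to the full cylinder over [B], so the estimate is only needed for
    integrals over entire circles. *)
Lemma integral_lty_last (R : realType) n (h : n.+1.-tuple (measurableTypeR R) -> \bar R)
    (g : n.-tuple (measurableTypeR R) -> \bar R) D B (c : R) :
  measurable D -> measurable B -> measurable_fun setT h -> measurable_fun setT g ->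
  (forall t, 0 <= h t)%E -> (forall t, 0 <= g t)%E -> 0 <= c ->
  (forall t s, D (snoc_tuple (t, s)) -> B t) ->
  (forall t, B t ->
    \int[uniform_prob (@lt0_2pi R)]_s h (snoc_tuple (t, s)) <= c%:E * g t)%E ->
  (\int[angle_measure R n]_(t in B) g t < +oo)%E ->
  (\int[angle_measure R n.+1]_(t in D) h t < +oo)%E.
Proof.
move=> mD mB mh mg h0 g0 c0 DB hg gB.
have mhD : measurable_fun setT (h \_ D).
  by apply/(measurable_restrictT _ mD); exact: measurable_funTS mh.
have hD0 t : (0 <= (h \_ D) t)%E by apply: erestrict_ge0 => ? _; exact: h0.
have mrhD : measurable_fun setT (fun x => (h \_ D) (@snoc_tuple R n x)).
  by apply: (measurableT_comp mhD); exact: measurable_snoc_tuple.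
have mrh : measurable_fun setT (fun x => h (@snoc_tuple R n x)).
  by apply: (measurableT_comp mh); exact: measurable_snoc_tuple.
rewrite integral_mkcond integral_angle_measure_last//.
rewrite (_ : (\int[angle_measure R n]_t _)%E = (\int[angle_measure R n]_(t in B)
    \int[uniform_prob (@lt0_2pi R)]_s (h \_ D) (snoc_tuple (t, s)))%E); last first.
  (* Over [t] outside [B] the fibre of [D] is empty, so the inner integral is 0. *)
  rewrite [RHS]integral_mkcond; apply: eq_integral => t _; rewrite patchE.
  case: ifPn => // /negP tB; apply: integral0_eq => s _; rewrite patchE.
  by case: ifPn => //; rewrite inE => /DB tB'; exfalso; apply: tB; rewrite inE.
apply: (integral_lty_scaled mB mB _ _ mg _ g0 c0 _ gB) => //.
- exact: (measurable_fun_fubini_tonelli_F (fun x => (h \_ D) (snoc_tuple x))).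
- by move=> t; exact: integral_ge0.
- move=> t Bt; apply: le_trans (hg t Bt); apply: ge0_le_integral => //.
  + exact: (measurableT_comp mrhD (pair1_measurable t)).
  + exact: (measurableT_comp mrh (pair1_measurable t)).
  + by move=> s _; rewrite patchE; case: ifP.
Qed.

(** * Consequences of the integrability of [sigma ^ (1 - q)] near [xi] *)

Section LocalIntegrability.
Variables (R : realType) (d : nat).
Local Notation C := R[i].
Local Notation RT := (measurableTypeR R).
Local Notation U := (uniform_prob (@lt0_2pi R)).
Variables (p : mpoly d.+1 C) (m : multinom d) (p1 p2 : mpoly d C).
Hypothesis hdeg : polydegree p = mnm_add (mnmwiden m) (mnm1 ord_max).
Hypothesis hp : p = mwiden p1 + mwiden p2 * mpolyX C (mnm1 ord_max).
Hypothesis hstable : stable p.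
Variable q : R.
Hypothesis hq : 1 <= q.
Local Notation q1 := (reflect_with m p1).
Local Notation q2 := (reflect_with m p2).

Lemma measurable_sigma (r1 r2 : mpoly d C) :
  measurable_fun setT (fun t : d.-tuple RT => sigma r1 r2 (torus_pt (tnth t))).
Proof.
by apply: measurable_funB; apply: measurable_funX; exact: measurable_modulus_meval.
Qed.

(** From [rho >= sigma / K ^ 2], because the exponent [1 - q] is not positive and reverses the
    inequality. *)
Lemma epow_rho_le (K : R) z : torus z -> meval z q1 != 0 -> 0 < K ->
  modulus (meval z q1) <= K ->
  (epow (rho q1 q2 z) (1 - q) <=
   ((K ^+ 2) `^ (q - 1))%:E * epow (sigma q1 q2 z) (1 - q))%E.
Proof.
move=> tz q10 K0 zK; rewrite /rho.
have X0 : 0 < modulus (meval z q1) by rewrite modulus_gt0.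
have := sigma_ge0 hdeg hp hstable tz.
rewrite le_eqVlt => /orP[/eqP <-|s0].
  (* At a zero of [sigma] both sides are infinite for [q > 1], as the constant is positive; for
     [q = 1] every power is 1. *)
  rewrite mul0r /epow eqxx/=; case: ifPn => [q_lt|].
    by rewrite gt0_muley ?leey// lte_fin powR_gt0// exprn_gt0.
  rewrite subr_lt0 -leNgt => q_le; have -> : q = 1 by apply/le_anti/andP.
  by rewrite subrr !powRr0 mul1e.
rewrite /epow gt_eqF ?divr_gt0 ?exprn_gt0//= gt_eqF//= -EFinM lee_fin.
rewrite powRM ?invr_ge0 ?exprn_ge0 ?modulus_ge0 ?(ltW s0)// mulrC.
rewrite ler_pM2r ?powR_gt0//.
have -> : (modulus (meval z q1) ^+ 2)^-1 `^ (1 - q) =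
    (modulus (meval z q1) ^+ 2) `^ (q - 1).
  by rewrite -powR_inv1 ?exprn_ge0 ?modulus_ge0// -powRrM mulN1r opprB.
apply: ge0_ler_powR; rewrite ?nnegrE ?subr_ge0 ?exprn_ge0 ?modulus_ge0 ?(ltW K0)//.
by rewrite ler_pXn2r ?nnegrE ?modulus_ge0 ?(ltW K0).
Qed.

Lemma measurable_angles_rho_dom : measurable (angles (rho_dom q1)).
Proof.
rewrite /rho_dom anglesI angles_torus setTI.
exact: measurable_angles_nonpole.
Qed.

Lemma torus_integral_rho_lty (e : R) (xi : 'I_d -> C) :
  (torus_integral (tball e xi)
     (fun z => epow (sigma q1 q2 z) (1 - q)) < +oo)%E ->
  (torus_integral (tball e xi `&` rho_dom q1)
     (fun z => epow (rho q1 q2 z) (1 - q)) < +oo)%E.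
Proof.
rewrite /torus_integral anglesI => foo.
have [K K0 Kq1] := modulus_meval_bounded q1.
have mB := measurable_angles_tball e xi.
have mD := measurable_angles_rho_dom.
have ms := measurable_epow (1 - q) (measurable_sigma q1 q2).
have mr : measurable_fun setT
    (fun t : d.-tuple RT => epow (rho q1 q2 (torus_pt (tnth t))) (1 - q)).
  apply: measurable_epow; apply: measurable_funM; first exact: measurable_sigma.
  apply: measurable_inv_ge0 => [t|]; first by rewrite exprn_ge0// modulus_ge0.
  by apply: measurable_funX; exact: measurable_modulus_meval.
apply: (integral_lty_scaled (c := (K ^+ 2) `^ (q - 1)) _ mB _ mr ms _ _ _ _ foo).
- exact: measurableI.
- exact: subIsetl.
- by move=> t; exact: epow_ge0.
- by move=> t; exact: epow_ge0.
- exact: powR_ge0.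
- by move=> t [_ [tt t0]]; apply: epow_rho_le => //; exact: Kq1.
Qed.

Lemma tball_rcons (e : R) (xi z : 'I_d -> C) (tau w : C) :
  tball e (rcons_pt xi tau) (rcons_pt z w) -> tball e xi z.
Proof.
move=> [tz ze]; split.
  by move=> i; have := tz (lift ord_max i); rewrite rcons_pt_lift.
apply: le_lt_trans ze; rewrite ler_wsqrtr// big_ord_recr/=.
under [X in _ <= X + _]eq_bigr => i _ do rewrite widen_lift_max !rcons_pt_lift.
by rewrite lerDl exprn_ge0// modulus_ge0.
Qed.

Lemma integral_density_pow_lty (e : R) (xi : 'I_d -> C) (tau : C) :
  (torus_integral (tball e xi)
     (fun z => epow (sigma q1 q2 z) (1 - q)) < +oo)%E ->
  (\int[angle_measure R d.+1]_(t in angles (tball e (rcons_pt xi tau)))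
     density_pow p m p1 p2 q t < +oo)%E.
Proof.
rewrite /torus_integral => foo.
have [K1 K10 K1P] := modulus_meval_bounded p1.
have [K2 K20 K2P] := modulus_meval_bounded p2.
pose K := K1 + K2.
have K0 : 0 < K by rewrite addr_gt0.
have mB := measurable_angles_tball e xi.
have mD := measurable_angles_tball e (rcons_pt xi tau).
have mH := measurable_density_pow p m p1 p2 q.
have ms := measurable_epow (1 - q) (measurable_sigma q1 q2).
have cB t : angles (tball e xi) t ->
    (\int[U]_s density_pow p m p1 p2 q (snoc_tuple (t, s)) <=
     ((K ^+ 2) `^ (q - 1))%:E * epow (sigma q1 q2 (torus_pt (tnth t))) (1 - q))%E.
  move=> -[tt _].
  under eq_integral => s _ do rewrite /density_pow torus_pt_rcons.
  apply: (integral_density_circle hdeg hp hstable hq tt K0).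
  by apply: lerD; [exact: K1P|exact: K2P].
apply: (integral_lty_last mD mB mH ms _ _ _ _ cB foo).
- by move=> t; exact: density_pow_ge0.
- by move=> t; exact: epow_ge0.
- exact: powR_ge0.
- by move=> t s; rewrite /angles/= torus_pt_rcons; exact: tball_rcons.
Qed.

End LocalIntegrability.

(** * From local to global integrability *)

Lemma integral_lty_setU dT (T : measurableType dT) (R : realType)
    (mu : {measure set T -> \bar R}) (A B : set T) (h : T -> \bar R) :
  measurable A -> measurable B -> measurable_fun setT h -> (forall t, 0 <= h t)%E ->
  (\int[mu]_(t in A) h t < +oo)%E -> (\int[mu]_(t in B) h t < +oo)%E ->
  (\int[mu]_(t in A `|` B) h t < +oo)%E.
Proof.
move=> mA mB mh h0 hA hB; rewrite -(setDUK (@subsetUl _ A B)).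
have mBA : measurable ((A `|` B) `\` A).
  by apply: measurableD => //; exact: measurableU.
rewrite ge0_integral_setU//; first last.
- by apply/disj_set2P; rewrite setDIK.
- exact: measurable_funTS.
apply: lte_add_pinfty => //; apply: le_lt_trans hB.
apply: ge0_subset_integral => //; first exact: measurable_funTS.
by move=> t [[]].
Qed.

Lemma integral_lty_cover dT (T : measurableType dT) (R : realType)
    (mu : {measure set T -> \bar R}) (I : choiceType) (s : seq I) (A : I -> set T)
    (h : T -> \bar R) :
  (forall i, measurable (A i)) -> measurable_fun setT h -> (forall t, 0 <= h t)%E ->
  (forall i, i \in s -> (\int[mu]_(t in A i) h t < +oo)%E) ->
  (forall t, exists2 i, i \in s & A i t) ->
  (\int[mu]_t h t < +oo)%E.
Proof.
move=> mA mh h0 hA cover.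
have -> : setT = \big[setU/set0]_(i <- s) A i.
  rewrite -bigcup_seq; apply/esym/seteqP; split => // t _.
  by have [i si Ait] := cover t; exists i.
elim: s hA {cover} => [|i s IHs] hA; first by rewrite big_nil integral_set0.
rewrite big_cons; apply: integral_lty_setU => //.
- exact: bigsetU_measurable.
- by apply: hA; rewrite inE eqxx.
- by apply: IHs => j sj; apply: hA; rewrite inE sj orbT.
Qed.

Section TorusCompact.
Variable R : realType.
Local Notation C := R[i].

Lemma unimodular_angle (z : C) : modulus z = 1 ->
  exists2 t : R, t \in `[- pi, pi] & z = (cos t +i* sin t)%C.
Proof.
case: z => a b z1.
have ab : a ^+ 2 + b ^+ 2 = 1.
  by have := modulus_sqr (a +i* b)%C; rewrite z1 expr1n.
have a1 : -1 <= a <= 1.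
  rewrite -ler_norml -(@ler_pXn2r _ 2)// ?nnegrE// expr1n.
  by rewrite -normrX ger0_norm ?sqr_ge0// -ab lerDl sqr_ge0.
have sa : Num.sqrt (1 - a ^+ 2) = `|b|.
  by rewrite -ab addrAC subrr add0r sqrtr_sqr.
have [b0|b0] := leP 0 b.
- exists (acos a); last by rewrite acosK ?in_itv// sin_acos// sa ger0_norm.
  rewrite in_itv/= acos_lepi// andbT.
  by rewrite (le_trans _ (acos_ge0 a1))// lerNl oppr0 pi_ge0.
- exists (- acos a).
    rewrite in_itv/= lerN2 acos_lepi//= (le_trans _ (pi_ge0 R))//.
    by rewrite lerNl oppr0 acos_ge0.
  by rewrite cosN sinN acosK ?in_itv// sin_acos// sa ltr0_norm// opprK.
Qed.

Lemma torus_finite_cover n (r : ('I_n -> C) -> R) : (forall z, torus z -> 0 < r z) ->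
  exists s : seq 'rV[R]_n, forall z, torus z ->
    exists2 v : 'rV[R]_n, v \in s &
      tball (r (torus_pt (fun i => v 0 i))) (torus_pt (fun i => v 0 i)) z.
Proof.
move=> r0; pose pt (v : 'rV[R]_n) := torus_pt (fun i => v 0 i).
pose dist (v w : 'rV[R]_n) := Num.sqrt (\sum_(i < n) modulus (pt w i - pt v i) ^+ 2).
pose K := [set v : 'rV[R]_n | forall i, `[- pi, pi]%classic (v 0 i)].
have cK : compact K.
  by apply: (@rV_compact _ _ (fun=> `[- pi, pi]%classic)) => i; exact: segment_compact.
have cvK : cover_compact K by rewrite -compact_cover.
have Pc (c : R) : continuous (fun _ : 'rV[R]_n => c).
  by apply: cst_continuous.
have PD (f g : 'rV[R]_n -> R) : continuous f -> continuous g ->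
    continuous (fun t => f t + g t).
  by move=> cf cg t; apply: continuousD; [exact: cf|exact: cg].
have PM (f g : 'rV[R]_n -> R) : continuous f -> continuous g ->
    continuous (fun t => f t * g t).
  by move=> cf cg t; apply: continuousM; [exact: cf|exact: cg].
have csum v (s : seq 'I_n) : continuous (fun w : 'rV[R]_n =>
    \sum_(i <- s) modulus (pt w i - pt v i) ^+ 2).
  elim: s => [|i s IHs].
    rewrite (_ : (fun w : 'rV[R]_n => _) = fun=> 0); first exact: Pc.
    by apply/funext => w; rewrite big_nil.
  rewrite (_ : (fun w : 'rV[R]_n => _) = fun w => modulus (pt w i - pt v i) ^+ 2 +
      \sum_(i <- s) modulus (pt w i - pt v i) ^+ 2); last first.
    by apply/funext => w; rewrite big_cons.
  apply: (PD _ _ _ IHs).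
  apply: (sqr_modulus_in PD PM).
  apply: (@ReIm_inD R 'rV[R]_n (fun f => continuous f) PD); last first.
    exact: (@ReIm_in_cst R 'rV[R]_n (fun f => continuous f) Pc).
  split => /= w.
  - apply: (@continuous_comp _ _ _ (fun w : 'rV[R]_n => w 0 i) (@cos R)).
      exact: coord_continuous.
    exact: continuous_cos.
  - apply: (@continuous_comp _ _ _ (fun w : 'rV[R]_n => w 0 i) (@sin R)).
      exact: coord_continuous.
    exact: continuous_sin.
have cdist v : continuous (dist v).
  move=> w; apply: (@continuous_comp _ _ _ (fun w : 'rV[R]_n =>
    \sum_(i < n) modulus (pt w i - pt v i) ^+ 2) (@Num.sqrt R)).
    exact: csum.
  exact: sqrt_continuous.
have opn v : open [set w | dist v w < r (pt v)].
  apply: (@open_comp _ _ (dist v) [set x | x < r (pt v)]).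
    by move=> w _; exact: cdist.
  exact: open_lt.
have [|D' _ D'K] := cvK _ setT
    (fun v => [set w | dist v w < r (pt v)]) (fun v _ => opn v).
  move=> v _; exists v => //=; rewrite /dist big1 ?sqrtr0 ?r0//.
    exact: torus_pt_torus.
  by move=> i _; rewrite subrr modulus0 expr0n.
exists (finmap.enum_fset D') => z tz.
have /choice[t tP] i : exists t : R, t \in `[- pi, pi] /\ z i = (cos t +i* sin t)%C.
  by have [t] := unimodular_angle (tz i); exists t.
pose v := \row_i t i.
have zv : z = pt v by apply/funext => i; rewrite /pt /torus_pt mxE; exact: (tP i).2.
have [|w Dw vw] := D'K v; first by move=> i; rewrite mxE; exact: (tP i).1.
by exists w => //; rewrite zv; split => //; exact: torus_pt_torus.
Qed.

End TorusCompact.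

Theorem theorem4p8 (R : realType) (d : nat) (hn : (3 <= d.+1)%N)
  (p : mpoly d.+1 R[i]) (m : multinom d) (p1 p2 : mpoly d R[i])
  (xi : 'I_d -> R[i]) (N : nat) (M : 'I_N -> set ('I_d -> R[i]))
  (q eps : R)
  (hphi : rif_denominator p)
  (hirr : irreducible_elt p)
  (hdeg : polydegree p = mnm_add (mnmwiden m) (mnm1 ord_max))
  (hp : p = mwiden p1 + mwiden p2 * mpolyX R[i] (mnm1 ord_max))
  (hxi : torus xi)
  (hline : forall tau, modulus tau = 1 -> meval (rcons_pt xi tau) p = 0)
  (hdim : torus_pure_dimension d.-1
            (Zsigma (reflect_with m p1) (reflect_with m p2)))
  (hM : forall i, torus_manifold d.-1 (M i))
  (hZrho : Zrho (reflect_with m p1) (reflect_with m p2)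
           = \bigcup_(i in [set: 'I_N]) M i)
  (hq : 1 <= q) (heps : 0 < eps)
  (hint : (torus_integral (tball eps xi)
             (fun z => epow (sigma (reflect_with m p1) (reflect_with m p2) z)
                            (1 - q)) < +oo)%E) :
  (exists delta : R, [/\ 0 < delta, delta <= eps &
     (torus_integral
        (tball delta xi `&` rho_dom (reflect_with m p1))
        (fun z => epow (rho (reflect_with m p1) (reflect_with m p2) z)
                       (1 - q)) < +oo)%E])
  /\ (forall tau, modulus tau = 1 ->
        local_Lp q (nonpole p) (partial ord_max (rif p)) (rcons_pt xi tau))
  /\ (global_Lp q (nonpole p) (partial ord_max (rif p)) <->
      forall z tau, torus z -> modulus tau = 1 -> z <> xi ->
        local_Lp q (nonpole p) (partial ord_max (rif p)) (rcons_pt z tau)).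
Proof.
have [hstable _] := hphi.
pose h := density_pow p m p1 p2 q.
have mh : measurable_fun setT h by exact: measurable_density_pow.
have h0 t : (0 <= h t)%E by exact: density_pow_ge0.
have LpE := Lp_integrable_density hdeg hp hstable hq.
have local_xi tau :
    (\int[angle_measure R d.+1]_(t in angles (tball eps (rcons_pt xi tau))) h t < +oo)%E.
  exact: (integral_density_pow_lty hdeg hp hstable hq tau hint).
split.
  exists eps; split; [exact: heps|exact: lexx|].
  exact: (torus_integral_rho_lty hdeg hp hstable hq hint).
split.
  move=> tau _; exists eps => //; apply/LpE; last exact: local_xi.
  exact: measurable_angles_tball.
have mT : measurable (angles (torus (R := R) (n := d.+1))) by rewrite angles_torus.
split.
  (* Any positive radius would do, the integral over the whole torus being finite. *)
  move=> /(LpE _ mT); rewrite angles_torus => hT z tau _ _ _; exists 1 => //.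
  have mB := measurable_angles_tball 1 (rcons_pt z tau).
  apply/LpE => //; apply: le_lt_trans hT.
  exact: ge0_subset_integral.
move=> hloc; apply/(LpE _ mT); rewrite angles_torus.
have /choice[r rP] : forall z : 'I_d.+1 -> R[i], exists r : R, torus z -> 0 < r /\
    (\int[angle_measure R d.+1]_(t in angles (tball r z)) h t < +oo)%E.
  move=> z; rewrite (rcons_pt_split z).
  set z' := fun i => z (lift ord_max i); set w := z ord_max.
  (* Over [xi] the radius [eps] works for every last coordinate; elsewhere the radius comes from
     [hloc]. Off the torus the chosen value 0 is a dummy. *)
  have [->|zxi] := pselect (z' = xi); first by exists eps => _; split.
  have [tz|ntz] := pselect (torus (rcons_pt z' w)); last by exists 0.
  have tz' : torus z' by move=> i; have := tz (lift ord_max i); rewrite rcons_pt_lift.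
  have tw : modulus w = 1 by have := tz ord_max; rewrite rcons_pt_max.
  have [r r0 hr] := hloc z' w tz' tw zxi.
  exists r => _; split => //; apply/LpE => //.
  exact: measurable_angles_tball.
have [s sP] := torus_finite_cover (fun z tz => (rP z tz).1).
pose c (v : 'rV[R]_d.+1) := torus_pt (fun i => v 0 i).
apply: (@integral_lty_cover _ _ _ _ _ s (fun v => angles (tball (r (c v)) (c v)))) => //.
- by move=> v; exact: measurable_angles_tball.
- by move=> v _; apply: (rP (c v) _).2; exact: torus_pt_torus.
- move=> t; have [v vs vt] := sP _ (torus_pt_torus (tnth t)).
  by exists v.
Qed.
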